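(* Let $n\ge 1$ be an integer and let $V_{8n}=\langle x,y : x^{2n}=y^4=1,\ yx=x^{-1}y^{-1},\ y^{-1}x=x^{-1}y\rangle$. Then the CN-spectrum and CN-energy of its commuting conjugacy class graph are $$\text{CN-spec}(\Gamma(V_{8n}))=\begin{cases} \{(-(2n-4))^{(2n-3)},\ ((2n-3)(2n-4))^1,\ 0^4\}, & \text{if } 2\mid n,\\ \{(-(2n-3))^{(2n-2)},\ ((2n-2)(2n-3))^1,\ 0^2\}, & \text{if } 2\nmid n, \end{cases}$$ and $$E_{CN}(\Gamma(V_{8n}))=\begin{cases} 2(2n-3)(2n-4), & \text{if } 2\mid n,\\ 2(2n-2)(2n-3), & \text{if } 2\nmid n. \end{cases}$$
   Context: For a finite non-abelian group $G$, the commuting conjugacy class graph $\Gamma(G)$ is the simple undirected graph whose vertices are the conjugacy classes of the non-central elements of $G$; two distinct vertices $a^G$ and $b^G$ are adjacent if there exist $a'\in a^G$, $b'\in b^G$ with $a'b'=b'a'$. For a finite simple graph $\mathcal{G}$ with vertices $v_1,\dots,v_N$, the common neighbourhood matrix $CN(\mathcal{G})$ is the $N\times N$ matrix whose $(i,j)$ entry is, for $i\ne j$, the number of vertices other than $v_i,v_j$ adjacent to both $v_i$ and $v_j$, and is $0$ for $i=j$. The CN-spectrum $\text{CN-spec}(\mathcal{G})$ is the multiset of eigenvalues of $CN(\mathcal{G})$; writing $\{\lambda_1^{\alpha_1},\dots,\lambda_k^{\alpha_k}\}$ means that $\lambda_i$ is listed $\alpha_i$ times (multiplicities of coinciding values add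 up; entries with exponent $0$ are absent). The CN-energy $E_{CN}(\mathcal{G})$ is the sum of the absolute values of the eigenvalues of $CN(\mathcal{G})$, counted with multiplicity. *)

(* Defs.v *)
From HB Require Import structures.
From mathcomp Require Import all_boot all_order all_algebra all_fingroup all_solvable.
From mathcomp Require Import algC.

Set Implicit Arguments.
Unset Strict Implicit.
Unset Printing Implicit Defensive.

Import GRing.Theory Num.Theory.

Record sgraph := SGraph {
  vertex : finType;
  adj : rel vertex;
  adj_sym : symmetric adj;
  adj_irr : irreflexive adj
}.

Section CommonNeighbourhood.
Local Open Scope ring_scope.

Definition common_nbrs (Gr : sgraph) (u v : vertex Gr) : {set vertex Gr} :=
  [set w | [&& w != u, w != v, adj u w & adj v w]].

(* The vertices are listed in the order of [enum]; the spectrum does not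
   depend on that choice. *)
Definition CN_matrix (Gr : sgraph) : 'M[algC]_#|vertex Gr| :=
  \matrix_(i, j)
    if i == j then 0 else #|common_nbrs (enum_val i) (enum_val j)|%:R.

(* The roots of the characteristic polynomial, with multiplicity. This is a
   multiset: the order of the list is unspecified, so it is only meaningful up
   to [perm_eq]. All eigenvalues are in [algC] since the matrix is integral. *)
Definition eigenvalues m (A : 'M[algC]_m) : seq algC :=
  sval (closed_field_poly_normal (char_poly A)).

Definition CN_spec (Gr : sgraph) : seq algC := eigenvalues (CN_matrix Gr).

Definition CN_energy (Gr : sgraph) : algC := \sum_(z <- CN_spec Gr) `|z|.

End CommonNeighbourhood.

Section CommutingConjugacyClassGraph.
Local Open Scope group_scope.

Variables (gT : finGroupType) (G : {group gT}).

Definition noncentral_classes : {set {set gT}} :=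
  [set a ^: G | a in G :\: 'Z(G)].

Definition ccc_vertex : finType := {A : {set gT} | A \in noncentral_classes}.

Definition ccc_adj : rel ccc_vertex := fun A B =>
  (A != B) && [exists a in val A, exists b in val B, a * b == b * a].

Lemma ccc_adj_sym : symmetric ccc_adj.
Proof.
have H (A B : ccc_vertex) : ccc_adj A B -> ccc_adj B A.
  case/andP=> nAB /existsP[a /andP[Aa /existsP[b /andP[Bb cab]]]].
  rewrite /ccc_adj eq_sym nAB; apply/existsP; exists b; rewrite Bb.
  by apply/existsP; exists a; rewrite Aa eq_sym.
by move=> A B; apply/idP/idP; apply: H.
Qed.

Lemma ccc_adj_irr : irreflexive ccc_adj.
Proof. by move=> A; rewrite /ccc_adj eqxx. Qed.

Definition ccc_graph : sgraph := SGraph ccc_adj_sym ccc_adj_irr.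

End CommutingConjugacyClassGraph.

(* Main.v *)
Require Import Defs.
From mathcomp Require Import all_boot all_order all_algebra all_fingroup all_solvable.
From mathcomp Require Import algC zify ring.

(** Put z = y^2. The relations say that z is central with z^2 = 1 and that
    y^-1 x y = x^-1 z, so H = <x, z> is an abelian subgroup of index 2. As soon
    as the order of the group is known to be 8n, H is the direct product of
    <x>, of order 2n, and <z>, of order 2. The relations only bound the order
    from above; the bound is attained because the same relations hold in a
    group of affine permutations of Z/2n x Z/2 (lemma V8n_model).

    In any nonabelian G with an abelian subgroup H of index 2, the center Z
    lies in H, and an element of H commutes with an element outside H only if
    it is central. Hence the classes of G split into those inside H, which
    have 2 elements, number m = (|H| - |Z|)/2 and form a clique, and those
    outside, which have |H|/|Z| elements and number |Z|; no edge joins the two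
    kinds. Elements outside H that commute differ by a central element. If
    multiplication by Z moves an outer class to at most one other class, then
    the outer classes have at most one neighbour each (CN_spec_abelian_index2).
    This holds here: a central element is x^(2k) z^j, and a x^(2k) z^k is the
    conjugate of a by x^k, so only multiplication by z can matter.

    Thus the common neighbourhood matrix is (m - 2)(J - I) on the clique and 0
    elsewhere, with eigenvalues (m - 1)(m - 2) once, -(m - 2) with multiplicity
    m - 1, and |Z| zeros (CN_spec_clique). Finally x^i z^j is central if and
    only if both n and 2 divide i, so |Z| = 4 and m = 2n - 2 for even n, while
    |Z| = 2 and m = 2n - 1 for odd n. *)

Set Implicit Arguments.
Unset Strict Implicit.
Unset Printing Implicit Defensive.

Import Order.TTheory GRing.Theory Num.Theory.

(** * The common neighbourhood spectrum of an isolated clique *)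

Section Spectrum.
Local Open Scope ring_scope.

(** The matrix determinant lemma. Both sides are determinants of the bordered
    matrix with blocks 1, v, u and diag d: clearing the first column with the
    corner 1 leaves the Schur complement diag d - u v, clearing it with the
    invertible block diag d leaves the scalar 1 - v (diag d)^-1 u. *)
Lemma det_diag_sub_rank1 (F : fieldType) N (d : 'rV[F]_N) (u : 'cV[F]_N)
    (v : 'rV[F]_N) :
    (forall i, d 0 i != 0) ->
  \det (diag_mx d - u *m v) =
    (\prod_i d 0 i) * (1 - \sum_i v 0 i * u i 0 / d 0 i).
Proof.
move=> nz_d; pose w : 'cV[F]_N := \col_i (u i 0 / d 0 i).
pose M := block_mx (1%:M : 'M[F]_1) v u (diag_mx d).
have detL : \det (block_mx 1%:M 0 (- u) 1%:M *m M) = \det (diag_mx d - u *m v).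
  rewrite mulmx_block !mul1mx !mul0mx !addr0 mulmx1 addNr mulNmx addrC.
  by rewrite det_ublock det1 mul1r.
have detR : \det (M *m block_mx 1%:M 0 (- w) 1%:M)
    = (\prod_i d 0 i) * (1 - \sum_i v 0 i * u i 0 / d 0 i).
  rewrite mulmx_block !mulmx1 !mulmx0 !add0r.
  have ->: u + diag_mx d *m - w = 0.
    rewrite mulmxN; apply/matrixP=> i j; rewrite mul_diag_mx !mxE ord1.
    by rewrite mulrCA divff // mulr1 subrr.
  rewrite det_ublock det_diag mulrC; congr (_ * _).
  rewrite det_mx11 mulmxN !mxE; congr (_ - _).
  by apply: eq_bigr => i _; rewrite !mxE mulrA.
by rewrite -detL -detR !det_mulmx !det_lblock !det1 !mul1r mulr1.
Qed.

Section CliqueMatrix.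
Variables (F : fieldType) (N : nat) (C : {set 'I_N}) (c : F).

Definition clique_mx : 'M[F]_N :=
  \matrix_(i, j) if [&& i != j, i \in C & j \in C] then c else 0.

(** With u the indicator of C, the characteristic matrix is the diagonal
    matrix with entries X + c on C and X off C, minus c u u^T; the determinant
    of such a rank-one perturbation is computed in the field of rational
    functions, where the diagonal entries become invertible. *)
Lemma char_poly_clique_mx : (0 < #|C|)%N ->
  char_poly clique_mx =
    ('X + c%:P) ^+ #|C|.-1 * ('X - (#|C|.-1%:R * c)%:P) * 'X ^+ (N - #|C|).
Proof.
move=> C_gt0; apply/eqP; rewrite -tofrac_eq; apply/eqP.
pose d : 'rV[{poly F}]_N := \row_i if i \in C then 'X + c%:P else 'X.
pose u : 'cV[{poly F}]_N := \col_i (i \in C)%:R.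
pose v : 'rV[{poly F}]_N := \row_i if i \in C then c%:P else 0.
have -> : char_poly clique_mx = \det (diag_mx d - u *m v).
  congr (\det _); apply/matrixP=> i j; rewrite !mxE big_ord1 !mxE.
  have [<-|ne_ij] := eqVneq i j; rewrite ?mulr1n ?mulr0n.
    by case: (i \in C); rewrite ?mul1r ?mul0r ?addrK ?subr0 // polyC0 subr0.
  by case: (i \in C) (j \in C) => [] []; rewrite ?mul1r ?mul0r ?polyC0.
have nzXc : 'X + c%:P != 0 :> {poly F}.
  by rewrite -(opprK c%:P) -polyCN polyXsubC_eq0.
pose f : {rmorphism {poly F} -> {fraction {poly F}}} := @tofrac _.
have nzd i : (map_mx f d) 0 i != 0.
  by rewrite !mxE /= tofrac_eq0; case: ifP => _; rewrite ?polyX_eq0.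
rewrite -[LHS]/(f _) -det_map_mx map_mxB map_mxM map_diag_mx.
rewrite det_diag_sub_rank1 //.
have -> : \prod_i map_mx f d 0 i = f (('X + c%:P) ^+ #|C| * 'X ^+ (N - #|C|)).
  under eq_bigr do rewrite mxE; rewrite -rmorph_prod; congr (f _).
  rewrite (bigID (mem C)) /=; congr (_ * _).
    by rewrite -prodr_const; apply: eq_bigr => i Ci; rewrite !mxE Ci.
  have -> : (N - #|C|)%N = #|~: C| by rewrite [RHS]cardsCs setCK card_ord.
  rewrite -prodr_const; apply: eq_big => i; first by rewrite inE.
  by move=> nCi; rewrite !mxE (negPf nCi).
have -> : \sum_i map_mx f v 0 i * map_mx f u i 0 / map_mx f d 0 i
    = (f c%:P / f ('X + c%:P)) *+ #|C|.
  rewrite (bigID (mem C)) /= [X in _ + X]big1 ?addr0 => [|i nCi]; last first.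
    by rewrite !mxE (negPf nCi) rmorph0 !mul0r.
  by rewrite -sumr_const; apply: eq_bigr => i Ci; rewrite !mxE Ci rmorph1 mulr1.
case: #|C| C_gt0 => // m _ /=.
have nzf : f ('X + c%:P) != 0 by rewrite /= tofrac_eq0.
have defE : f ('X + c%:P) * (1 - f c%:P / f ('X + c%:P) *+ m.+1)
    = f ('X - (m%:R * c)%:P).
  rewrite mulrBr mulr1 mulrnAr mulrCA divff // mulr1 -rmorphMn -rmorphB.
  by rewrite mulrSr opprD addrACA subrr addr0 mulr_natl polyCMn.
rewrite -[RHS]/(f _) exprS !rmorphM !rmorphXn -polyCM.
rewrite -{}defE mulrAC; congr (_ * _).
by rewrite -mulrA mulrCA.
Qed.

End CliqueMatrix.

Lemma eigenvalues_of_char_poly m (A : 'M[algC]_m) (s : seq algC) :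
  char_poly A = \prod_(z <- s) ('X - z%:P) -> perm_eq (eigenvalues A) s.
Proof.
move=> defA; rewrite /eigenvalues.
case: (closed_field_poly_normal _) => r /= /esym.
rewrite (monicP (char_poly_monic A)) scale1r defA.
by move/Pdiv.Field.prod_XsubC_eq.
Qed.

(** If a nonempty clique C is a union of components and no two vertices
    outside it have a common neighbour, then the only nonzero entries of the
    common neighbourhood matrix are the off-diagonal ones inside C, which all
    equal |C| - 2. *)
Lemma CN_spec_clique (Gr : sgraph) (C : {set vertex Gr}) (k : nat) :
    (0 < #|C|)%N -> #|~: C| = k ->
    {in C &, forall u v, u != v -> adj u v} ->
    {in C & ~: C, forall u v, ~~ adj u v} ->
    {in ~: C &, forall u v, u != v -> common_nbrs u v = set0} ->
  perm_eq (CN_spec Gr)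
    (nseq #|C|.-1 (- (#|C|%:R - 2))
       ++ nseq 1 ((#|C|%:R - 1) * (#|C|%:R - 2)) ++ nseq k 0).
Proof.
move=> C_gt0 <- adjC closedC isoC.
(* For |C| = 1 this is -1, but then C has no off-diagonal entry. *)
pose c : algC := #|C|%:R - 2.
pose D : {set 'I_#|vertex Gr|} := [set i | enum_val i \in C].
have cardD : #|D| = #|C|.
  rewrite -(card_imset D enum_val_inj); apply: eq_card => w.
  apply/imsetP/idP=> [[i]|Cw]; first by rewrite inE => Ci ->.
  by exists (enum_rank w); rewrite ?inE enum_rankK.
have closedC' u v : u \in C -> adj u v -> v \in C.
  by move=> Cu; apply: contraTT => nCv; apply: closedC; rewrite ?inE.
have defCN : CN_matrix Gr = clique_mx D c.
  apply/matrixP=> i j; rewrite !mxE !inE.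
  have [//|ne_ij] := eqVneq i j.
  have {ne_ij}ne_uv: enum_val i != enum_val j by rewrite (inj_eq enum_val_inj).
  move: (enum_val i) (enum_val j) ne_uv => u v ne_uv /=.
  case: ifP => [/andP[Cu Cv]|nCuv].
    have -> : common_nbrs u v = C :\ u :\ v.
      apply/setP=> w; rewrite !inE andbCA; apply: andb_id2l => wv.
      apply: andb_id2l => wu; apply/andP/idP=> [[uw _]|Cw].
        exact: closedC' uw.
      by rewrite !adjC // eq_sym.
    rewrite /c (cardsD1 u C) Cu (cardsD1 v (C :\ u)) !inE Cv eq_sym ne_uv !add1n.
    by rewrite -addn2 natrD addrK.
  suff -> : common_nbrs u v = set0 by rewrite cards0.
  apply/eqP/set0Pn=> -[w]; rewrite inE => /and4P[wu wv uw vw].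
  have [Cw|nCw] := boolP (w \in C).
    have nbrC t : adj t w -> t \in C.
      by move=> tw; apply: closedC' Cw _; rewrite adj_sym.
    by rewrite (nbrC u uw) (nbrC v vw) in nCuv.
  have nC t : adj t w -> t \in ~: C.
    by move=> tw; rewrite inE; apply: contra nCw => Ct; apply: closedC' tw.
  have := isoC u v (nC _ uw) (nC _ vw) ne_uv.
  by move/setP/(_ w); rewrite !inE wu wv uw vw.
apply: eigenvalues_of_char_poly; rewrite defCN char_poly_clique_mx cardD //.
rewrite !big_cat /= !big_nseq !iter_mulr_1 big_seq1 -/c polyCN opprK subr0.
rewrite -mulrA -[X in (X - _)%N](cardsC C) addKn -subn1 natrB //.
Qed.

(** The clique contributes m - 1 copies of -(m - 2) and one (m - 1)(m - 2),
    whose absolute values add up to the same amount; for m = 1 the negative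
    number m - 2 is multiplied by 0. *)
Lemma sum_norm_clique_spec (m k : nat) : (0 < m)%N ->
  \sum_(z <- nseq m.-1 (- (m%:R - 2))
              ++ nseq 1 ((m%:R - 1) * (m%:R - 2)) ++ nseq k 0) `|z|
    = 2 * (m%:R - 1) * (m%:R - 2) :> algC.
Proof.
case: m => // m _; rewrite !big_cat !big_nseq !iter_addr_0 /=.
rewrite normr0 mul0rn addr0 mulr1n normrN normrM -natr1 addrK.
case: m => [|m]; first by rewrite mulr0n normr0 !(mulr0, mul0r) addr0.
have -> : m.+1%:R + 1 - 2 = m%:R :> algC by rewrite -natr1; ring.
rewrite !normr_nat -mulr_natr; ring.
Qed.

End Spectrum.

(** * Commuting conjugacy classes when an abelian subgroup has index 2 *)

Section ClassVertices.
Local Open Scope group_scope.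

Lemma card_classes_uniform (gT : finGroupType) (G : {group gT}) (S : {set gT}) k :
    G \subset 'N(S) -> {in S, forall a, #|a ^: G| = k} ->
  #|S| = (#|[set a ^: G | a in S]| * k)%N.
Proof.
move=> nSG cardS; apply: card_uniform_partition.
  by move=> _ /imsetP[a Sa ->]; apply: cardS.
have actS : [acts G, on S | 'J] by rewrite astabsJ.
by have := orbit_partition actS.
Qed.

Variables (gT : finGroupType) (G : {group gT}).
Local Notation V := (ccc_vertex G).

Lemma ccc_vertexP (A : V) : exists2 a, a \in G :\: 'Z(G) & val A = a ^: G.
Proof. by case/imsetP: (valP A) => a Ga ->; exists a. Qed.

Lemma ccc_vertex_of_class a :
  a \in G :\: 'Z(G) -> exists A : V, val A = a ^: G.
Proof.
move=> GZa; have Va : a ^: G \in noncentral_classes G by apply: imset_f.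
by exists (exist (fun X : {set gT} => X \in noncentral_classes G) _ Va).
Qed.

Lemma ccc_vertex_class (A : V) a : a \in val A -> val A = a ^: G.
Proof. by have [b _ ->] := ccc_vertexP A => /class_eqP. Qed.

Lemma ccc_vertex_repr (A : V) : exists a, a \in val A.
Proof. by have [a _ ->] := ccc_vertexP A; exists a; apply: class_refl. Qed.

End ClassVertices.

Section AbelianIndexTwo.
Local Open Scope group_scope.
Variables (gT : finGroupType) (G H : {group gT}).
Hypotheses (sHG : H \subset G) (abH : abelian H) (indexH : #|G : H| = 2%N).
Hypothesis nabG : ~~ abelian G.
Let nsHG : H <| G := index2_normal sHG indexH.

Lemma mem_coset_index2 a g :
  a \in G :\: H -> g \in G :\: H -> a^-1 * g \in H.
Proof.
move=> /setDP[Ga nHa]; suff -> : G :\: H = a *: H by rewrite mem_lcoset.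
apply/esym/eqP; rewrite eqEcard card_lcoset cardsD (setIidPr sHG).
rewrite -(Lagrange sHG) indexH muln2 -addnn addnK leqnn andbT.
apply/subsetP=> _ /lcosetP[h Hh ->].
by rewrite inE groupMr // nHa groupM // (subsetP sHG).
Qed.

(** Such an h commutes with the abelian group H and with a, which together
    generate G. *)
Lemma comm_out_center h a :
  h \in H -> a \in G :\: H -> commute h a -> h \in 'Z(G).
Proof.
move=> Hh Ga cha; rewrite inE (subsetP sHG) //=; apply/centP=> g Gg.
have [Hg|nHg] := boolP (g \in H); first exact: (centsP abH).
rewrite -(mulKVg a g); apply: commuteM => //; apply: (centsP abH) => //.
by apply: mem_coset_index2 => //; rewrite inE nHg.
Qed.

(** If H were central, then G would be abelian, since two elements outside H
    differ by an element of H. *)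
Lemma index2_not_central : ~~ (H \subset 'Z(G)).
Proof.
apply: contra nabG => /subsetP sHZ; apply/centsP=> g Gg g' Gg'.
have [/sHZ/setIP[_ /centP cg]|nHg] := boolP (g \in H); first exact: cg.
have [/sHZ/setIP[_ /centP cg]|nHg'] := boolP (g' \in H).
  by apply: commute_sym; apply: cg.
have /sHZ/setIP[_ /centP cg] : g^-1 * g' \in H.
  by apply: mem_coset_index2; rewrite inE ?nHg ?nHg'.
rewrite -(mulKVg g g').
by apply: commuteM => //; apply: commute_sym; apply: cg.
Qed.

Lemma center_sub_index2 : 'Z(G) \subset H.
Proof.
apply/subsetP=> c /setIP[Gc cGc]; apply: contraR index2_not_central => nHc.
apply/subsetP=> h Hh; apply: (@comm_out_center h c); rewrite ?inE ?nHc //.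
by apply: commute_sym; apply: (centP cGc); apply: (subsetP sHG).
Qed.

(** The centraliser of h contains the abelian group H, and it contains nothing
    else because h is not central. *)
Lemma card_class_in h : h \in H :\: 'Z(G) -> #|h ^: G| = 2%N.
Proof.
case/setDP=> Hh nZh; rewrite -index_cent1 -indexH; congr #|_ : _|.
apply/eqP; rewrite eqEsubset subsetI sHG /=; apply/andP; split.
  apply/subsetP=> g /setIP[Gg /cent1P cgh]; apply: contraR nZh => nHg.
  by apply: (@comm_out_center h g); rewrite // inE nHg.
by apply/subsetP=> g Hg; apply/cent1P; apply: (centsP abH).
Qed.

(** The centraliser of a meets H in the center and, containing a, is mapped
    onto G / H, so it has order 2|Z(G)|. *)
Lemma card_class_out a : a \in G :\: H -> (#|a ^: G| * #|'Z(G)|)%N = #|H|.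
Proof.
move=> GHa; have /setDP[Ga nHa] := GHa.
have defCH : 'C_G[a] :&: H = 'Z(G).
  apply/eqP; rewrite eqEsubset; apply/andP; split; apply/subsetP=> c.
    case/setIP=> /setIP[_ /cent1P cca] Hc.
    by apply: comm_out_center GHa _ => //; apply: commute_sym.
  move=> Zc; rewrite inE (subsetP center_sub_index2) // andbT.
  by have /setIP[Gc /centP cc] := Zc; rewrite inE Gc; apply/cent1P/cc.
have defG : 'C_G[a] * H = G.
  apply/eqP; rewrite eqEsubset mul_subG ?subsetIl //=.
  apply/subsetP=> g Gg; have [Hg|nHg] := boolP (g \in H).
    by rewrite -[g]mul1g mem_mulg.
  rewrite -(mulKVg a g); apply: mem_mulg; first by rewrite inE Ga cent1id.
  by apply: mem_coset_index2; rewrite // inE nHg.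
have := mul_cardG 'C_G[a] H; rewrite defG defCH.
rewrite -(Lagrange (subsetIl G 'C[a])) index_cent1 -mulnA.
by move/eqP; rewrite eqn_pmul2l ?cardG_gt0 // => /eqP.
Qed.

Local Notation V := (ccc_vertex G).
Local Notation inner := [set A : V | val A \subset H].

Lemma class_sub_index2 a : a \in G -> (a ^: G \subset H) = (a \in H).
Proof. by move=> Ga; rewrite class_sub_norm // normal_norm. Qed.

Lemma ccc_vertex_mem (A : V) a :
  a \in val A -> a \in G :\: 'Z(G) /\ (A \in inner) = (a \in H).
Proof.
move=> Aa; have defA := ccc_vertex_class Aa.
have Ga : a \in G :\: 'Z(G).
  have [b Gb defB] := ccc_vertexP A; rewrite defB in Aa.
  apply: subsetP Aa; rewrite class_sub_norm //.
  by rewrite normsD ?normG // gFnorm.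
by split=> //; rewrite inE defA class_sub_index2 //; case/setDP: Ga.
Qed.

Lemma val_inner : val @: inner = [set a ^: G | a in H :\: 'Z(G)].
Proof.
apply/setP=> X; apply/imsetP/imsetP=> [[A innA ->]|[a /setDP[Ha nZa] ->]].
  have [a Aa] := ccc_vertex_repr A; have [GZa] := ccc_vertex_mem Aa.
  rewrite innA => /esym Ha; exists a; last exact: ccc_vertex_class.
  by rewrite inE Ha andbT; case/setDP: GZa.
have GZa : a \in G :\: 'Z(G) by rewrite inE nZa (subsetP sHG).
have [A defA] := ccc_vertex_of_class GZa; exists A => //.
have Aa : a \in val A by rewrite defA class_refl.
by rewrite (ccc_vertex_mem Aa).2.
Qed.

Lemma val_outer : val @: (~: inner) = [set a ^: G | a in G :\: H].
Proof.
apply/setP=> X; apply/imsetP/imsetP=> [[A innA ->]|[a /setDP[Ga nHa] ->]].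
  have [a Aa] := ccc_vertex_repr A; have [GZa defA] := ccc_vertex_mem Aa.
  exists a; last exact: ccc_vertex_class.
  by move: innA; rewrite !in_setC defA in_setD => ->; case/setDP: GZa.
have GZa : a \in G :\: 'Z(G).
  by rewrite inE Ga andbT; apply: contra nHa; apply: (subsetP center_sub_index2).
have [A defA] := ccc_vertex_of_class GZa; exists A => //.
have Aa : a \in val A by rewrite defA class_refl.
by rewrite in_setC (ccc_vertex_mem Aa).2.
Qed.

Lemma card_inner : (#|H| = #|inner| * 2 + #|'Z(G)|)%N.
Proof.
rewrite -(card_imset (inner : {set V}) val_inj) val_inner.
rewrite -card_classes_uniform; last exact: card_class_in.
  rewrite cardsD (setIidPr center_sub_index2) subnK //.
  by rewrite subset_leq_card ?center_sub_index2.
by rewrite normsD ?gFnorm // normal_norm.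
Qed.

Lemma card_outer : #|~: inner| = #|'Z(G)|.
Proof.
have ratio_gt0 : (0 < #|H| %/ #|'Z(G)|)%N.
  by rewrite divn_gt0 // subset_leq_card ?center_sub_index2.
apply/eqP; rewrite -(eqn_pmul2r ratio_gt0).
rewrite -(card_imset (~: inner : {set V}) val_inj) val_outer.
rewrite -card_classes_uniform.
- rewrite mulnC divnK ?cardSg ?center_sub_index2 //.
  by rewrite cardsD (setIidPr sHG) -(Lagrange sHG) indexH muln2 -addnn addnK.
- by rewrite normsD ?normG // normal_norm.
by move=> a GHa; rewrite -(card_class_out GHa) mulnK.
Qed.

Lemma inner_gt0 : (0 < #|inner|)%N.
Proof.
rewrite lt0n; apply: contra index2_not_central => /eqP in0.
suff /eqP -> : 'Z(G) == H by [].
by rewrite eqEcard center_sub_index2 /= [X in (X <= _)%N]card_inner in0.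
Qed.

Variable z0 : gT.
Hypothesis Zz0 : z0 \in 'Z(G).
(* Multiplication by the center permutes the outer classes with orbits of
   size at most 2. *)
Hypothesis twist : {in G :\: H & 'Z(G), forall a c,
  (a * c \in a ^: G) || (a * c \in (a * z0) ^: G)}.

(** Commuting elements a1, b outside H differ by an element of H commuting
    with a1, that is, by a central element; the hypothesis on z0 then leaves a
    single possible class for b besides that of a1. *)
Lemma outer_neighbour (A B : V) a :
    A \notin inner -> a \in val A -> ccc_adj A B ->
  B \notin inner /\ val B = (a * z0) ^: G.
Proof.
move=> nA Aa /andP[neAB /existsP[a1 /andP[Aa1 /existsP[b /andP[Bb /eqP cab]]]]].
have [/setDP[Ga nZa] Ha] := ccc_vertex_mem Aa.
have [/setDP[Ga1 nZa1] Ha1] := ccc_vertex_mem Aa1.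
have [/setDP[Gb nZb] Hb] := ccc_vertex_mem Bb.
have GHa1 : a1 \in G :\: H by rewrite inE -Ha1 nA.
have nHb : b \notin H.
  by apply: contra nZb => Hb'; apply: comm_out_center GHa1 _.
have Zc : a1^-1 * b \in 'Z(G).
  apply: (comm_out_center (a := a1)) => //.
    by apply: mem_coset_index2 => //; rewrite inE nHb.
  by apply: commute_sym; apply: commuteM => //; apply: commuteV.
split; first by rewrite Hb.
have := twist GHa1 Zc; rewrite mulKVg -(ccc_vertex_class Aa1) => /orP[Ab|].
  case/eqP: neAB; apply: val_inj.
  by rewrite (ccc_vertex_class Ab) (ccc_vertex_class Bb).
rewrite (ccc_vertex_class Bb) => /class_eqP ->.
have : a1 \in a ^: G by rewrite -(ccc_vertex_class Aa).
case/imsetP=> g Gg ->; have [_ /centP cz] := setIP Zz0.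
have -> : a ^ g * z0 = (a * z0) ^ g.
  by rewrite conjMg (conjgE z0) (cz g Gg) mulKg.
by rewrite classGidl.
Qed.

(** The inner classes form a clique because H is abelian; an outer class has at
    most one neighbour, so two distinct outer classes have none in common. *)
Lemma CN_spec_abelian_index2 :
  perm_eq (CN_spec (ccc_graph G))
    (nseq #|inner|.-1 (- (#|inner|%:R - 2))
       ++ nseq 1 ((#|inner|%:R - 1) * (#|inner|%:R - 2))
       ++ nseq #|'Z(G)| 0)%R.
Proof.
apply: (CN_spec_clique (Gr := ccc_graph G)); rewrite ?inner_gt0 ?card_outer //.
- move=> A B; have [a Aa] := ccc_vertex_repr A.
  have [b Bb] := ccc_vertex_repr B.
  have [_ ->] := ccc_vertex_mem Aa; have [_ ->] := ccc_vertex_mem Bb.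
  move=> Ha Hb neAB; apply/andP; split=> //; apply/existsP; exists a.
  rewrite Aa; apply/existsP; exists b; rewrite Bb; apply/eqP.
  exact: (centsP abH).
- move=> A B inA; rewrite in_setC => nB; rewrite adj_sym.
  have [b Bb] := ccc_vertex_repr B; have [GZb Hb] := ccc_vertex_mem Bb.
  by apply: contraL inA => /(outer_neighbour nB Bb)[].
move=> A B; rewrite !in_setC => nA nB neAB; apply/eqP/set0Pn=> -[D].
rewrite inE => /and4P[_ _ AD BD].
have [a Aa] := ccc_vertex_repr A; have [d Dd] := ccc_vertex_repr D.
have [nD _] := outer_neighbour nA Aa AD.
case/eqP: neAB; apply: val_inj; rewrite adj_sym in AD; rewrite adj_sym in BD.
have [_ ->] := outer_neighbour nD Dd AD.
by have [_ ->] := outer_neighbour nD Dd BD.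
Qed.

End AbelianIndexTwo.

(** * A permutation group of order at least 8n satisfying the relations *)

Section Model.
Local Open Scope ring_scope.
Variable n : nat.
Hypothesis n_gt0 : (0 < n)%N.
Local Notation Zn := 'Z_(2 * n).
Local Notation point := (Zn * bool)%type.

Let n2_gt1 : (1 < 2 * n)%N.
Proof. by rewrite mul2n -addnn (leq_add n_gt0). Qed.

Lemma odd_ZpD (i j : Zn) : odd (i + j)%R = odd i (+) odd j.
Proof. by rewrite -oddD [LHS]/= odd_mod // Zp_cast // oddM. Qed.

Lemma odd_ZpN (i : Zn) : odd (- i)%R = odd i.
Proof. by apply: (can_inj (addKb (odd i))); rewrite -odd_ZpD subrr addbb. Qed.

Lemma odd_Zp1 : odd (1%R : Zn).
Proof. by case: (2 * n)%N n2_gt1 => [|[|k]]. Qed.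

(** Points stand for the elements x^i z^b of the subgroup generated by x and
    z = y^2: shift is translation by x, and flip is conjugation by y, which
    sends x^i z^b to x^-i z^(b+i). *)
Definition shift (p : point) : point := (p.1 + 1, p.2).
Definition flip (p : point) : point := (- p.1, p.2 (+) odd p.1).

Lemma shift_inj : injective shift.
Proof.
by apply: (can_inj (g := fun p => (p.1 - 1, p.2))) => -[i b]; rewrite /shift addrK.
Qed.

Lemma flipK : involutive flip.
Proof. by move=> [i b]; rewrite /flip /= opprK odd_ZpN -addbA addbb addbF. Qed.

Definition permX := perm shift_inj.
Definition permT := perm (can_inj flipK).

(** In the presented group x * y is an involution acting on the abelian
    subgroup as y does; this is flip, whence y = x^-1 * flip. *)
Definition permY := (permX^-1 * permT)%g.

Lemma permXE i b : permX (i, b) = (i + 1, b). Proof. by rewrite permE. Qed.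
Lemma permTE i b : permT (i, b) = (- i, b (+) odd i). Proof. by rewrite permE. Qed.

Lemma permX_expE k i b : (permX ^+ k)%g (i, b) = (i + k%:R, b).
Proof.
elim: k => [|k IHk]; first by rewrite expg0 perm1 addr0.
by rewrite expgSr permM IHk permXE -addrA natr1.
Qed.

Local Open Scope group_scope.

Lemma permTT : permT * permT = 1.
Proof. by apply/permP=> p; rewrite permM perm1 !permE flipK. Qed.

Lemma permTV : permT^-1 = permT.
Proof. by apply/eqP; rewrite eq_invg_mul permTT. Qed.

(** Substituting y = x^-1 * flip turns the relation y^-1 x = x^-1 y into this
    identity. *)
Lemma permX2_inverted : permX ^+ 2 * permT * permX ^+ 2 = permT.
Proof.
apply/permP=> -[i b]; rewrite (permM (permX ^+ 2 * permT)) (permM (permX ^+ 2)).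
rewrite !permX_expE !permTE permX_expE opprD addrNK mulr2n !odd_ZpD odd_Zp1.
by rewrite addbb addbF.
Qed.

Lemma permYE i b : permY (i, b) = (1 - i, b (+) ~~ odd i)%R.
Proof.
have -> : (i, b) = permX (i - 1, b)%R by rewrite permXE addrNK.
by rewrite /permY permM permK permTE opprB odd_ZpD odd_ZpN odd_Zp1 addbT.
Qed.

Lemma permY2E i b : (permY ^+ 2) (i, b) = (i, ~~ b).
Proof.
rewrite expgS expg1 permM !permYE subKr odd_ZpD odd_ZpN odd_Zp1 addTb negbK.
by rewrite -addbA addNb addbb addbT.
Qed.

(** The permutation group is transitive on 4n points, and flip is a nontrivial
    element of the stabiliser of the origin. *)
Lemma V8n_model : exists (gT : finGroupType) (M : {group gT}),
  (8 * n <= #|M|)%N /\ M \homg Grp (x : y :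
           x ^+ (2 * n) = y ^+ 4 = 1,
           y * x = x^-1 * y^-1,
           y^-1 * x = x^-1 * y).
Proof.
exists _, (<[permX]> <*> <[permY]>)%G; split; last first.
  apply/existsP; exists (permX, permY); rewrite /= !xpair_eqE /=.
  have -> : permX ^+ (2 * n) = 1.
    by apply/permP=> -[i b]; rewrite permX_expE perm1 /= pchar_Zp // addr0.
  have -> : permY ^+ 4 = 1.
    apply/permP=> -[i b]; rewrite (expgM permY 2 2) expgS expg1 permM.
    by rewrite !permY2E perm1 /= negbK.
  rewrite !eqxx /=; apply/andP; split.
    by rewrite /permY invMg invgK permTV mulgA.
  rewrite /permY invMg invgK permTV; apply/eqP; apply: (mulgI (permX ^+ 2)).
  transitivity permT; first by rewrite -[RHS]permX2_inverted expgS expg1 !mulgA.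
  by rewrite expgS expg1 -!mulgA !mulKVg.
have MX : permX \in <[permX]> <*> <[permY]> by rewrite mem_gen // inE cycle_id.
have MY : permY \in <[permX]> <*> <[permY]> by rewrite mem_gen // inE cycle_id orbT.
have MT : permT \in <[permX]> <*> <[permY]> by rewrite -(mulKVg permX permT) groupM.
rewrite -(card_orbit_stab 'P _ ((0%R, false) : point)).
have -> : orbit 'P (<[permX]> <*> <[permY]>) (0%R, false) = [set: point].
  apply/setP=> -[i b]; rewrite inE; apply/orbitP.
  exists (permX ^+ i * (permY ^+ 2) ^+ b); first by rewrite groupM ?groupX.
  rewrite /= apermE permM permX_expE add0r natr_Zp; case: b; rewrite ?perm1 //.
  exact: permY2E.
have stab_gt1 : (1 < #|'C_(<[permX]> <*> <[permY]>)[(0%R, false) : point | 'P]|)%N.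
  rewrite cardG_gt1; apply: contraTneq isT => C1.
  have : permT \in 'C_(<[permX]> <*> <[permY]>)[(0%R, false) : point | 'P].
    by rewrite inE MT; apply/astab1P; rewrite /= apermE permTE oppr0.
  rewrite C1 => /set1P T1; have := permTE 1%R false.
  by rewrite T1 perm1 odd_Zp1 => -[].
apply: leq_trans (leq_mul (leqnn _) stab_gt1).
by rewrite cardsT card_prod card_bool card_ord Zp_cast // -(mulnA _ 2 2)%N mulnAC.
Qed.

End Model.

(** * Structure of the presented group *)

Section V8n.
Local Open Scope group_scope.
Variables (n : nat) (gT : finGroupType) (G : {group gT}) (x y : gT).
Hypotheses (n_gt0 : (0 < n)%N) (defG : <[x]> <*> <[y]> = G).
Hypotheses (xn : x ^+ (2 * n) = 1) (y4 : y ^+ 4 = 1).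
Hypotheses (yx : y * x = x^-1 * y^-1) (yVx : y^-1 * x = x^-1 * y).
Hypothesis leG : (8 * n <= #|G|)%N.

Variable z : gT.
Hypothesis defz : z = y ^+ 2.
Let H := (<[x]> <*> <[z]>)%G.

Let Gx : x \in G. Proof. by rewrite -defG mem_gen // inE cycle_id. Qed.
Let Gy : y \in G. Proof. by rewrite -defG mem_gen // inE cycle_id orbT. Qed.

Lemma z_mulz : z * z = 1.
Proof. by rewrite defz -expgD. Qed.

Lemma z_sqr : z ^+ 2 = 1.
Proof. by rewrite expgS expg1 z_mulz. Qed.

Lemma z_inv : z^-1 = z.
Proof. by apply/eqP; rewrite eq_invg_mul z_mulz. Qed.

Lemma x_conj_y : x ^ y = x^-1 * z.
Proof. by rewrite conjgE mulgA yVx defz -mulgA. Qed.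

(** The relations give x y = y^-1 x^-1 and x^-1 y = y^-1 x, so moving x through
    y^2 = z turns x z into z^-1 x, and z^-1 = z. *)
Lemma commute_zx : commute z x.
Proof.
have xy : x * y = y^-1 * x^-1.
  by apply: (mulIg x); rewrite mulgKV -mulgA yx mulKVg.
rewrite /commute -{1}z_inv defz expgS expg1 mulgA xy -(mulgA _ _ y) -yVx mulgA.
by rewrite invMg.
Qed.

Lemma V8nHE : H = <[x]> * <[z]> :> {set gT}.
Proof.
rewrite /= cent_joinEr // cent_cycle cycle_subG.
by apply/cent1P; apply: commute_zx.
Qed.

Lemma abelian_V8nH : abelian H.
Proof.
rewrite abelianY !cycle_abelian /= cent_cycle cycle_subG.
by apply/cent1P; exact: commute_zx.
Qed.

Lemma sub_V8nH : H \subset G.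
Proof. by rewrite join_subG !cycle_subG Gx defz groupX. Qed.

Let Hx : x \in H. Proof. by rewrite mem_gen // inE cycle_id. Qed.
Let Hz : z \in H. Proof. by rewrite mem_gen // inE cycle_id orbT. Qed.

Lemma y_norm_V8nH : y \in 'N(H).
Proof.
rewrite inE conjYg join_subG -!cycleJ !cycle_subG x_conj_y.
rewrite groupM ?groupV //=.
by rewrite defz conjXg conjgE mulKg -defz.
Qed.

Lemma index_V8nH_le2 : (#|G : H| <= 2)%N.
Proof.
have defG' : H <*> <[y]> = G.
  apply/eqP; rewrite eqEsubset join_subG sub_V8nH cycle_subG Gy -defG.
  by rewrite genS // setSU // joing_subl.
have nHY : <[y]> \subset 'N(H) by rewrite cycle_subG y_norm_V8nH.
have nHG : G \subset 'N(H) by rewrite -defG' join_subG normG.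
rewrite -card_quotient // -{1}defG' quotientYidl //.
rewrite quotient_cycle ?y_norm_V8nH // dvdn_leq // -[#|_|]/#[_] order_dvdn.
by rewrite -morphX ?y_norm_V8nH //= -defz coset_id.
Qed.

(** The relations bound |G : H| by 2, #[x] by 2n and #[z] by 2, hence |G| by
    8n; as |G| is at least 8n, every bound is attained. *)
Lemma V8n_orders :
  [/\ #|G : H| = 2%N, #|H| = (4 * n)%N, #[x] = (2 * n)%N, #[z] = 2%N
    & <[x]> :&: <[z]> = 1].
Proof.
have lex : (#[x] <= 2 * n)%N by rewrite dvdn_leq ?muln_gt0 // order_dvdn xn.
have lez : (#[z] <= 2)%N by rewrite dvdn_leq // order_dvdn z_sqr.
have := mul_cardG <[x]> <[z]>; rewrite -V8nHE -!orderE => cM.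
have := leG; rewrite -(Lagrange sub_V8nH) => leG'.
have := index_V8nH_le2.
have : (0 < #|<[x]> :&: <[z]>|)%N by rewrite cardG_gt0.
move: cM leG' lex lez.
set a := #[x]; set b := #[z]; set h := #|_|; set c := #|_|; set d := #|_ : _|.
move=> cM leG' lex lez c1 d2.
have ab : (a * b <= 2 * n * 2)%N by apply: leq_mul.
have dh : (h * d <= h * 2)%N by rewrite leq_mul2l d2 orbT.
have hc : (h <= h * c)%N by rewrite leq_pmulr.
have hE : h = (4 * n)%N by lia.
have c_1 : c = 1%N by nia.
by split; [nia | | nia | nia | apply: card1_trivg].
Qed.

Lemma V8nH_expP h : h \in H -> exists i j, h = x ^+ i * z ^+ j.
Proof.
rewrite V8nHE => /mulsgP[_ _ /cycleP[i ->] /cycleP[j ->] ->].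
by exists i, j.
Qed.

Lemma expg_x_eq_z i j : x ^+ i = z ^+ j -> (2 * n %| i)%N && (2 %| j)%N.
Proof.
move=> eq_ij; have [_ _ ox oz tiXZ] := V8n_orders.
rewrite -{1}ox -oz !order_dvdn -eq_ij andbb -in_set1 -[[set 1]]tiXZ inE.
by rewrite mem_cycle eq_ij mem_cycle.
Qed.

Lemma nonabelian_V8n : ~~ abelian G.
Proof.
apply/negP=> /centsP/(_ _ Gx _ Gy)/commgP/conjg_fixP.
rewrite x_conj_y => /(canRL (mulKVg x)) xx.
by have := expg_x_eq_z (esym xx : x ^+ 2 = z ^+ 1); rewrite dvdn1 andbF.
Qed.

Lemma center_sub_V8nH : 'Z(G) \subset H.
Proof.
have [indexH _ _ _ _] := V8n_orders.
exact: center_sub_index2 sub_V8nH abelian_V8nH indexH nonabelian_V8n.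
Qed.

Lemma y_outside : y \in G :\: H.
Proof.
rewrite inE Gy andbT; apply: contra nonabelian_V8n => Hy.
apply: abelianS abelian_V8nH.
by rewrite -defG join_subG !cycle_subG Hx.
Qed.

(** An element outside H is y times an element of H, and H is abelian, so it
    acts on H as y does. *)
Lemma conj_x_outside a i : a \in G :\: H -> (x ^+ i) ^ a = x ^- i * z ^+ i.
Proof.
move=> GHa; have [indexH _ _ _ _] := V8n_orders.
have Ha := mem_coset_index2 sub_V8nH indexH y_outside GHa.
rewrite -(mulKVg y a) conjgM conjXg x_conj_y expgMn; last first.
  by apply: commute_sym; apply: commuteV; apply: commute_zx.
rewrite expgVn; apply/conjg_fixP/commgP.
apply: (centsP abelian_V8nH); last exact: Ha.
by rewrite groupM ?groupV ?groupX.
Qed.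

(** Conjugation by y fixes x^i z^j exactly when x^(2i) = z^i; as x and z are
    independent of orders 2n and 2, this says that n and 2 both divide i. *)
Lemma center_exponent i j :
  (x ^+ i * z ^+ j \in 'Z(G)) = (lcmn n 2 %| i)%N.
Proof.
rewrite dvdn_lcm.
have Hxz : x ^+ i * z ^+ j \in H by rewrite groupM ?groupX.
have zy : z ^ y = z.
  by apply/conjg_fixP/commgP; rewrite defz; apply/commute_sym/commuteX.
have conjE : (x ^+ i * z ^+ j) ^ y = x ^- i * z ^+ i * z ^+ j.
  by rewrite conjMg (conj_x_outside _ y_outside) conjXg zy.
apply/idP/idP=> [/setIP[_ /centP/(_ y Gy) c]|/andP[ni i2]].
  move/commgP/conjg_fixP: c; rewrite conjE => /mulIg/(canRL (mulKVg _)).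
  rewrite -expgD => /esym/expg_x_eq_z; rewrite addnn -mul2n dvdn_pmul2l //.
apply: (comm_out_center sub_V8nH abelian_V8nH) y_outside _ => //.
  by case: V8n_orders.
apply/commgP/conjg_fixP; rewrite conjE; congr (_ * _).
apply: (mulgI (x ^+ i)); rewrite mulKVg -expgD addnn -mul2n.
have -> : z ^+ i = 1.
  by have [k ->] := dvdnP i2; rewrite mulnC expgM z_sqr expg1n.
by have [k ->] := dvdnP ni; rewrite mulnCA mulnC expgM xn expg1n.
Qed.

Lemma z_central : z \in 'Z(G).
Proof. by have := center_exponent 0 1; rewrite expg0 mul1g dvdn0 => ->. Qed.

Lemma V8n_centerE : 'Z(G) = <[x ^+ lcmn n 2]> * <[z]>.
Proof.
apply/setP=> c; apply/idP/mulsgP=> [Zc|[_ _ /cycleP[i ->] /cycleP[j ->] ->]].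
  have [i [j defc]] := V8nH_expP (subsetP center_sub_V8nH c Zc).
  move: Zc; rewrite defc center_exponent.
  case/dvdnP=> k ->; exists (x ^+ (k * lcmn n 2)) (z ^+ j) => //.
    by rewrite mulnC expgM mem_cycle.
  exact: mem_cycle.
by rewrite -expgM center_exponent dvdn_mulr.
Qed.

Lemma card_V8n_center : #|'Z(G)| = (if 2 %| n then 4 else 2)%N.
Proof.
have [_ _ ox oz tiXZ] := V8n_orders.
have L2 : (lcmn n 2 %| 2 * n)%N by rewrite dvdn_lcm dvdn_mull ?dvdn_mulr.
rewrite V8n_centerE TI_cardMg; last first.
  by apply/trivgP; rewrite -tiXZ setSI // cycle_subG mem_cycle.
rewrite -!orderE oz orderXdiv ox //; case: ifP => n2.
  by rewrite (lcmn_idPl n2) mulnK.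
have n2c : coprime n 2 by rewrite coprimen2 -[odd n]negbK -dvdn2 n2.
have := muln_lcm_gcd n 2; rewrite (eqP n2c) muln1 => ->.
by rewrite (mulnC n) divnn muln_gt0 n_gt0.
Qed.

(** A central c has the form x^(2k) z^j, and conjugation by x^k multiplies a by
    x^(2k) z^k: so a c is conjugate to a up to a power of z. *)
Lemma V8n_twist : {in G :\: H & 'Z(G), forall a c,
  (a * c \in a ^: G) || (a * c \in (a * z) ^: G)}.
Proof.
move=> a c GHa Zc.
have [i [j defc]] := V8nH_expP (subsetP center_sub_V8nH c Zc).
move: Zc; rewrite {}defc center_exponent.
rewrite dvdn_lcm => /andP[_ /dvdnP[k ->]].
have conja : a ^ (x ^+ k) = a * (x ^+ (k * 2) * z ^+ k).
  rewrite conjgE mulgA (conjgC _ a) conjVg conj_x_outside // invMg invgK -expgVn z_inv.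
  rewrite -!mulgA muln2 -addnn expgD; congr (_ * _).
  by rewrite -expgD; apply: commuteX2 commute_zx.
have -> : a * (x ^+ (k * 2) * z ^+ j) = a ^ (x ^+ k) * z ^+ (k + j).
  rewrite conja -!mulgA -expgD addnA addnn -mul2n expgD expgM.
  by rewrite z_sqr expg1n mul1g.
have [_ _ _ oz _] := V8n_orders.
have -> : z ^+ (k + j) = z ^+ odd (k + j) by rewrite -modn2 -oz expg_mod_order.
case: (odd _); last by rewrite mulg1 memJ_class // groupX.
have zx : z ^ (x ^+ k) = z by apply/conjg_fixP/commgP; apply: commuteX commute_zx.
by rewrite expg1 -{2}zx -conjMg memJ_class ?orbT // groupX.
Qed.

End V8n.

(** * The spectrum and the energy *)

Local Open Scope ring_scope.

Theorem theorem2p7 (n : nat) (gT : finGroupType) (G : {group gT})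
  (hn : (1 <= n)%N)
  (hG : (G \isog Grp (x : y :
           x ^+ (2 * n) = y ^+ 4 = 1,
           y * x = x^-1 * y^-1,
           y^-1 * x = x^-1 * y))%g) :
  perm_eq (CN_spec (ccc_graph G))
    (if (2 %| n)%N then
       nseq (2 * n - 3) (- (2 * n%:R - 4))
         ++ nseq 1 ((2 * n%:R - 3) * (2 * n%:R - 4)) ++ nseq 4 0
     else
       nseq (2 * n - 2) (- (2 * n%:R - 3))
         ++ nseq 1 ((2 * n%:R - 2) * (2 * n%:R - 3)) ++ nseq 2 0)
  /\
  CN_energy (ccc_graph G) =
    (if (2 %| n)%N then 2 * (2 * n%:R - 3) * (2 * n%:R - 4)
     else 2 * (2 * n%:R - 2) * (2 * n%:R - 3)).
Proof.
(* The model bounds |G| from below, the relations give everything else. *)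
have [rT [M [leM homM]]] := V8n_model hn.
have leG : (8 * n <= #|G|)%N.
  by apply: leq_trans leM _; apply: leq_homg; rewrite hG.
have /existsP[[x y] /eqP[defG xn y4 yx yVx]] := isoGrp_hom hG.
have [indexH cardH _ _ _] := V8n_orders hn defG xn y4 yx yVx leG erefl.
have nabG := nonabelian_V8n hn defG xn y4 yx yVx leG erefl.
have sHG := sub_V8nH defG erefl.
have abH := abelian_V8nH y4 yx yVx erefl.
have Zz := z_central hn defG xn y4 yx yVx leG erefl.
have := CN_spec_abelian_index2 sHG abH indexH nabG Zz
  (V8n_twist hn defG xn y4 yx yVx leG erefl).
have := card_inner sHG abH indexH nabG.
have := inner_gt0 sHG abH indexH nabG.
rewrite cardH (card_V8n_center hn defG xn y4 yx yVx leG erefl).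
set m := #|_| => m_gt0 cardm spec.
have -> : CN_energy (ccc_graph G) = 2 * (m%:R - 1) * (m%:R - 2).
  by rewrite /CN_energy (perm_big _ spec) sum_norm_clique_spec.
move: cardm spec; case: ifP => n2 cardm.
  have -> : m%:R = 2 * n%:R - 2 :> algC.
    by apply/(canRL (addrK _)); rewrite -natrM -natrD; congr _%:R; lia.
  have -> : m.-1 = (2 * n - 3)%N by lia.
  have -> : 2 * n%:R - 2 - 1 = 2 * n%:R - 3 :> algC by ring.
  by have -> : 2 * n%:R - 2 - 2 = 2 * n%:R - 4 :> algC by ring.
have -> : m%:R = 2 * n%:R - 1 :> algC.
  by apply/(canRL (addrK _)); rewrite -natrM natr1; congr _%:R; lia.
have -> : m.-1 = (2 * n - 2)%N by lia.
have -> : 2 * n%:R - 1 - 1 = 2 * n%:R - 2 :> algC by ring.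
by have -> : 2 * n%:R - 1 - 2 = 2 * n%:R - 3 :> algC by ring.
Qed.
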